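(* Let $\mathfrak{g}$ be a finite dimensional quasitriangular Lie bialgebra over $k$, and let $D(\mathfrak{g})$ be its Drinfeld double. Let $(\mathfrak{q},\beta,\varphi)$ be any $\mathfrak{g}$-quasi-Frobenius Lie algebra. Then there exists a representation $\rho: D(\mathfrak{g})\rightarrow \mathfrak{gl}(\mathfrak{q})$ such that $\rho|_{\mathfrak{g}}=\varphi$ and $(\mathfrak{q},\beta,\rho)$ is a $D(\mathfrak{g})$-quasi-Frobenius Lie algebra.
   Context: $k$ is a field of characteristic zero. A quasi-Frobenius Lie algebra over $k$ is a pair $(\mathfrak{q},\beta)$ where $\mathfrak{q}$ is a Lie algebra over $k$ and $\beta:\mathfrak{q}\times\mathfrak{q}\to k$ is a nondegenerate skew-symmetric bilinear form satisfying the 2-cocycle condition $\beta([u,v],w)+\beta([v,w],u)+\beta([w,u],v)=0$ for all $u,v,w\in\mathfrak{q}$. For a finite dimensional Lie algebra $\mathfrak{h}$ over $k$, an $\mathfrak{h}$-quasi-Frobenius Lie algebra is a triple $(\mathfrak{q},\beta,\rho)$ where $(\mathfrak{q},\beta)$ is a quasi-Frobenius Lie algebra and $\rho:\mathfrak{h}\to\mathfrak{gl}(\mathfrak{q})$, $x\mapsto\rho_x$, is a representation such that each $\rho_x$ is a derivation of $\mathfrak{q}$ and $\beta(\rho_x(u),v)+\beta(u,\rho_x(v))=0$ for all $x\in\mathfrak{h}$, $u,v\in\mathfrak{q}$. A Lie bialgebra is a pair $(\mathfrak{g},\gamma)$ where $\mathfrak{g}$ is a Lie algebra and $\gamma:\mathfrak{g}\to\mathfrak{g}\wedge\mathfrak{g}\subset\mathfrak{g}\otimes\mathfrak{g}$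 is linear such that the dual map $\gamma^\ast$ restricted to $\mathfrak{g}^\ast\otimes\mathfrak{g}^\ast$ is a Lie bracket on $\mathfrak{g}^\ast$, and $\gamma([x,y])=ad^{(2)}_x\gamma(y)-ad^{(2)}_y\gamma(x)$ for all $x,y\in\mathfrak{g}$, where $ad^{(2)}_x(y\otimes z)=[x,y]\otimes z+y\otimes[x,z]$. It is quasitriangular if $\gamma=\delta r$, i.e. $\gamma(x)=ad^{(2)}_x r$, for some $r=\sum_i a_i\otimes b_i\in\mathfrak{g}\otimes\mathfrak{g}$ (the r-matrix) satisfying the classical Yang-Baxter equation $$\sum_{i,j}[a_i,a_j]\otimes b_i\otimes b_j+\sum_{i,j}a_i\otimes[b_i,a_j]\otimes b_j+\sum_{i,j}a_i\otimes a_j\otimes[b_i,b_j]=0.$$ The Drinfeld double $D(\mathfrak{g})$ of a finite dimensional Lie bialgebra $(\mathfrak{g},\gamma)$ is, as a Lie algebra, the vector space $\mathfrak{g}\oplus\mathfrak{g}^\ast$ containing $\mathfrak{g}$ and $\mathfrak{g}^\ast$ (with bracket $\gamma^\ast$, i.e. $[\xi,\eta](x)=(\xi\otimes\eta)(\gamma(x))$) as Lie subalgebras, with mixed bracket $[x,\xi]=ad^\ast_x\xi-ad^\ast_\xi x$ for $x\in\mathfrak{g}$, $\xi\in\mathfrak{g}^\ast$, where $ad^\ast_x:=-(ad_x)^t:\mathfrak{g}^\ast\to\mathfrak{g}^\ast$ and $ad^\ast_\xi:=-(ad_\xi)^t:\mathfrak{g}\to\mathfrak{g}$ (using $\mathfrak{g}^{\ast\ast}=\mathfrak{g}$).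 *)

(* Defs.v *)
From HB Require Import structures.
From mathcomp Require Import all_boot all_order all_algebra.

Set Implicit Arguments.
Unset Strict Implicit.
Unset Printing Implicit Defensive.

Import GRing.Theory.
Local Open Scope ring_scope.

Notation dual U := 'Hom(U, _^o).

(* A tensor is given by its coordinates in the basis e_i (x) f_j, where e and f *)
(* are the standard bases of U and V. The lemmas tens_linearl, tens_linearr,    *)
(* tens_lift_tens and tens_ext below are the universal property of U (x) V.     *)
Notation tensor U V := 'M_(\dim {:U}, \dim {:V}).

Section Tensor.

Variables (k : fieldType) (U V : vectType k).

Definition tens (u : U) (v : V) : tensor U V :=
  \matrix_(i, j) (coord (vbasis {:U}) i u * coord (vbasis {:V}) j v).

(* The linear map on U (x) V induced by a bilinear map b. *)
Definition tens_lift (W : lmodType k) (b : U -> V -> W) (t : tensor U V) : W :=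
  \sum_i \sum_j t i j *: b (vbasis {:U})`_i (vbasis {:V})`_j.

End Tensor.

Notation "u \ox v" := (tens u v)
  (at level 40, left associativity, format "u  \ox  v") : ring_scope.

Section TensorTheory.

Variables (k : fieldType) (U V : vectType k).

Lemma tens_linearl (v : V) : linear (fun u : U => u \ox v).
Proof.
by move=> a u u'; apply/matrixP=> i j; rewrite !mxE linearP mulrDl mulrA.
Qed.

Lemma tens_linearr (u : U) : linear (fun v : V => u \ox v).
Proof.
by move=> a v v'; apply/matrixP=> i j; rewrite !mxE linearP mulrDr mulrCA.
Qed.

Lemma tens_lift_linear (W : lmodType k) (b : U -> V -> W) :
  linear (tens_lift b).
Proof.
move=> a t t'; rewrite /tens_lift scaler_sumr -big_split; apply: eq_bigr => i _.
rewrite scaler_sumr -big_split; apply: eq_bigr => j _.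
by rewrite !mxE scalerDl scalerA.
Qed.

Lemma tens_lift_tens (W : lmodType k) (b : U -> V -> W) (u : U) (v : V) :
    (forall y, linear (b^~ y)) -> (forall x, linear (b x)) ->
  tens_lift b (u \ox v) = b u v.
Proof.
move=> bl br.
pose fl y : {linear U -> W} :=
  HB.pack (b^~ y) (GRing.isLinear.Build k U W _ (b^~ y) (bl y)).
pose fr x : {linear V -> W} :=
  HB.pack (b x) (GRing.isLinear.Build k V W _ (b x) (br x)).
rewrite [in RHS](coord_vbasis (memvf u)).
have -> x : b x v = fl v x by [].
rewrite linear_sum; apply: eq_bigr => i _; rewrite linearZ /=.
have -> x : b x v = fr x v by [].
rewrite [in RHS](coord_vbasis (memvf v)) linear_sum scaler_sumr.
by apply: eq_bigr => j _; rewrite linearZ /= scalerA mxE.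
Qed.

Lemma tens_ext (W : lmodType k) (f g : {linear tensor U V -> W}) :
  (forall u v, f (u \ox v) = g (u \ox v)) -> f =1 g.
Proof.
move=> fg t.
have coordE (T : vectType k) (i j : 'I_(\dim {:T})) :
    coord (vbasis {:T}) j (vbasis {:T})`_i = (i == j)%:R.
  by apply: coord_free; exact: basis_free (vbasisP _).
have -> : t = \sum_i \sum_j
    t i j *: ((vbasis {:U})`_i \ox (vbasis {:V})`_j).
  rewrite {1}(matrix_sum_delta t); apply: eq_bigr => i _; apply: eq_bigr => j _.
  congr (_ *: _); apply/matrixP=> i' j'.
  by rewrite mxE [RHS]mxE (coordE U i i') (coordE V j j') -natrM mulnb
             (eq_sym i) (eq_sym j).
rewrite !linear_sum; apply: eq_bigr => i _.
by rewrite !linear_sum; apply: eq_bigr => j _; rewrite !linearZ /= fg.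
Qed.

End TensorTheory.

Section Lie.

Variable k : fieldType.

Record lie_bracket (V : lmodType k) (br : V -> V -> V) : Prop := LieBracket {
  lie_linearl : forall y, linear (br^~ y);
  lie_linearr : forall x, linear (br x);
  lie_alternating : forall x, br x x = 0;
  lie_jacobi : forall x y z,
    br x (br y z) + br y (br z x) + br z (br x y) = 0 }.

Record quasi_frobenius (q : lmodType k) (br : q -> q -> q)
    (beta : {skew_symmetric q}) : Prop := QuasiFrobenius {
  qf_lie : lie_bracket br;
  qf_nondegenerate : forall u, (forall v, beta u v = 0) -> u = 0;
  qf_cocycle : forall u v w,
    beta (br u v) w + beta (br v w) u + beta (br w u) v = 0 }.

Record lie_representation (h : vectType k) (hbr : h -> h -> h) (q : lmodType k)
    (rho : h -> {linear q -> q}) : Prop := LieRepresentation {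
  rep_linear : forall u, linear (fun x => rho x u);
  rep_bracket : forall x y u,
    rho (hbr x y) u = rho x (rho y u) - rho y (rho x u) }.

(* (q, beta, rho) is an h-quasi-Frobenius Lie algebra, including the            *)
(* requirement that h is a Lie algebra.                                         *)
Record equivariant_quasi_frobenius (h : vectType k) (hbr : h -> h -> h)
    (q : lmodType k) (qbr : q -> q -> q) (beta : {skew_symmetric q})
    (rho : h -> {linear q -> q}) : Prop := EquivariantQuasiFrobenius {
  eqf_lie : lie_bracket hbr;
  eqf_quasi_frobenius : quasi_frobenius qbr beta;
  eqf_representation : lie_representation hbr rho;
  eqf_derivation : forall x u v,
    rho x (qbr u v) = qbr (rho x u) v + qbr u (rho x v);
  eqf_invariant : forall x u v, beta (rho x u) v + beta u (rho x v) = 0 }.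

End Lie.

Section LieBialgebra.

Variables (k : fieldType) (g : vectType k) (br : g -> g -> g).
Implicit Types (gamma : 'Hom(g, tensor g g)) (xi eta : dual g).

Definition ad2 (x : g) : tensor g g -> tensor g g :=
  tens_lift (fun y z => br x y \ox z + y \ox br x z).

(* t lies in the span of the tensors y (x) z - z (x) y. *)
Definition in_wedge (t : tensor g g) : Prop :=
  exists s : seq (g * g), t = \sum_(p <- s) (p.1 \ox p.2 - p.2 \ox p.1).

Definition dual_bracket gamma xi eta : dual g :=
  linfun (fun x : g =>
    tens_lift (fun y z : g => (xi y * eta z : k^o)) (gamma x)).

Record lie_bialgebra gamma : Prop := LieBialgebra {
  bialg_lie : lie_bracket br;
  bialg_wedge : forall x, in_wedge (gamma x);
  bialg_dual_lie : lie_bracket (dual_bracket gamma);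
  bialg_cocycle : forall x y,
    gamma (br x y) = ad2 x (gamma y) - ad2 y (gamma x) }.

(* The element \sum_i a_i (x) b_i is given as the list of the pairs (a_i, b_i). *)
Definition cybe (r : seq (g * g)) : Prop :=
  \sum_(p <- r) \sum_(p' <- r) br p.1 p'.1 \ox p.2 \ox p'.2
  + \sum_(p <- r) \sum_(p' <- r) p.1 \ox br p.2 p'.1 \ox p'.2
  + \sum_(p <- r) \sum_(p' <- r) p.1 \ox p'.1 \ox br p.2 p'.2 = 0.

Definition quasitriangular gamma : Prop :=
  exists2 r : seq (g * g), cybe r &
    forall x, gamma x = ad2 x (\sum_(p <- r) p.1 \ox p.2).

End LieBialgebra.

Section Coadjoint.

Variable k : fieldType.

Definition transpose (U V : vectType k) (f : 'Hom(U, V)) :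
  'Hom(dual V, dual U) := linfun (fun zeta : dual V => (zeta \o f)%VF).

Definition coad (V : vectType k) (br : V -> V -> V) (x : V) : 'End(dual V) :=
  - transpose (linfun (br x)).

Definition bidual (V : vectType k) : 'Hom(V, dual (dual V)) :=
  linfun (fun x : V => linfun (fun zeta : dual V => zeta x)).

Definition dual_coad (g : vectType k) (gamma : 'Hom(g, tensor g g))
    (xi : dual g) : 'End(g) :=
  ((bidual g)^-1 \o coad (dual_bracket gamma) xi \o bidual g)%VF.

End Coadjoint.

Notation drinfeld_double g := (g * dual g)%type.

(* [x, y] and [xi, eta] are the brackets of g and of its dual, the mixed bracket *)
(* is [x, eta] = ad*_x eta - ad*_eta x, and [xi, y] = - [y, xi].                 *)
Definition double_bracket (k : fieldType) (g : vectType k) (br : g -> g -> g)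
    (gamma : 'Hom(g, tensor g g)) (a b : drinfeld_double g) :
    drinfeld_double g :=
  let: (x, xi) := a in let: (y, eta) := b in
  (br x y - dual_coad gamma eta x + dual_coad gamma xi y,
   dual_bracket gamma xi eta + coad br x eta - coad br y xi).

Section Sanity.

Variable k : fieldType.

Lemma transposeE (U V : vectType k) (f : 'Hom(U, V)) zeta u :
  transpose f zeta u = zeta (f u).
Proof.
have lin : linear (fun zeta : dual V => (zeta \o f)%VF).
  by move=> a z z'; apply/lfunP=> w; rewrite !lfunE /= !lfunE /= !lfunE.
pose F : {linear dual V -> dual U} :=
  HB.pack (fun zeta : dual V => (zeta \o f)%VF)
    (GRing.isLinear.Build k (dual V) (dual U) _ _ lin).
by have := lfunE F zeta => /= ->; rewrite lfunE.
Qed.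

Lemma coadE (V : vectType k) (br : V -> V -> V) x zeta y :
  linear (br x) -> coad br x zeta y = - zeta (br x y).
Proof.
move=> lin; rewrite /coad opp_lfunE opp_lfunE transposeE.
pose F : {linear V -> V} :=
  HB.pack (br x) (GRing.isLinear.Build k V V _ _ lin).
by have := lfunE F y => /= ->.
Qed.

Lemma dual_bracketE (g : vectType k) (gamma : 'Hom(g, tensor g g)) xi eta x :
  dual_bracket gamma xi eta x =
    tens_lift (fun y z : g => (xi y * eta z : k^o)) (gamma x).
Proof.
set b := fun y z : g => _.
have lin : linear (fun x : g => tens_lift b (gamma x)).
  by move=> a y z; rewrite linearP tens_lift_linear.
pose F : {linear g -> k^o} :=
  HB.pack (fun x : g => tens_lift b (gamma x))
    (GRing.isLinear.Build k g k^o _ _ lin).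
by have := lfunE F x => /= <-.
Qed.

Lemma bidualE (V : vectType k) (x : V) zeta : bidual V x zeta = zeta x.
Proof.
have lin1 y : linear (fun zeta : dual V => zeta y).
  by move=> a z z'; rewrite !lfunE /= !lfunE.
pose F y : {linear dual V -> k^o} :=
  HB.pack (fun zeta : dual V => zeta y)
    (GRing.isLinear.Build k (dual V) k^o _ _ (lin1 y)).
have lin : linear (fun y => linfun (F y)).
  by move=> a y z; apply/lfunP=> w;
    rewrite add_lfunE scale_lfunE !(lfunE (F _)) /= linearP.
pose G : {linear V -> dual (dual V)} :=
  HB.pack (fun y => linfun (F y))
    (GRing.isLinear.Build k V (dual (dual V)) _ _ lin).
have -> : bidual V x = linfun (F x) by exact: (lfunE G x).
exact: (lfunE (F x) zeta).
Qed.

Lemma dual_coadE (g : vectType k) (gamma : 'Hom(g, tensor g g))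
    (xi eta : dual g) x :
    linear (dual_bracket gamma xi) ->
  eta (dual_coad gamma xi x) = - dual_bracket gamma xi eta x.
Proof.
move=> lin.
have bidual_inj : lker (bidual g) == 0%VS.
  apply/lker0P => u v uv; rewrite (coord_vbasis (memvf u)).
  rewrite [RHS](coord_vbasis (memvf v)); apply: eq_bigr => i _; congr (_ *: _).
  pose c : {linear g -> k^o} := coord (vbasis {:g}) i.
  by have := congr1 (fun f : dual (dual g) => f (linfun c)) uv;
    rewrite /= !bidualE !lfunE.
have dimH : dim (dual (dual g)) = dim g by rewrite /dim /= -[RHS](muln1 (dim g)) -[RHS]muln1.
have full : limg (bidual g) = fullv.
  apply/eqP; rewrite eqEdim subvf /= limg_dim_eq; last first.
    by rewrite (eqP bidual_inj) capv0.
  by rewrite !dimvf dimH.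
rewrite -[eta _]bidualE /dual_coad !comp_lfunE limg_lfunVK ?full ?memvf //.
by rewrite coadE // bidualE.
Qed.

End Sanity.

(* Main.v *)
(** Pairing the r-matrix with a functional, [R xi = \sum_i xi(a_i) b_i], turns
    the classical Yang-Baxter equation into [R [xi, eta] = [R xi, R eta]] and
    [gamma = delta r] into the compatibility with the mixed brackets, so that
    [(x, xi) |-> x + R xi] is a Lie algebra morphism from the double onto g
    extending the identity of g.  The representation [phi] is pulled back along
    it.  That the double is a Lie algebra at all is checked by evaluating each
    component of the Jacobiator on functionals, resp. on vectors: the terms
    cancel by the two Jacobi identities and the cocycle condition. *)
Require Import Defs.
From HB Require Import structures.
From mathcomp Require Import all_boot all_order all_algebra.
From mathcomp Require Import ring.

Set Implicit Arguments.
Unset Strict Implicit.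
Unset Printing Implicit Defensive.

Import GRing.Theory.
Local Open Scope ring_scope.

(** * Additivity, homogeneity and antisymmetry of a Lie bracket *)

Section LieBracketTheory.

Variables (k : fieldType) (V : lmodType k) (br : V -> V -> V).
Hypothesis lieV : lie_bracket br.

Let brl y : {linear V -> V} :=
  HB.pack (br^~ y) (GRing.isLinear.Build k V V _ (br^~ y) (lie_linearl lieV y)).
Let brr x : {linear V -> V} :=
  HB.pack (br x) (GRing.isLinear.Build k V V _ (br x) (lie_linearr lieV x)).

Lemma lieDl y : {morph br^~ y : u v / u + v}.
Proof. exact: (linearD (brl y)). Qed.

Lemma lieDr x : {morph br x : u v / u + v}.
Proof. exact: (linearD (brr x)). Qed.

Lemma lieBl y : {morph br^~ y : u v / u - v}.
Proof. exact: (linearB (brl y)). Qed.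

Lemma lieBr x : {morph br x : u v / u - v}.
Proof. exact: (linearB (brr x)). Qed.

Lemma lieZl y a : {morph br^~ y : u / a *: u}.
Proof. exact: (linearZ_LR (brl y) a). Qed.

Lemma lieZr x a : {morph br x : u / a *: u}.
Proof. exact: (linearZ_LR (brr x) a). Qed.

Lemma lieNr x : {morph br x : u / - u}.
Proof. exact: (linearN (brr x)). Qed.

Lemma lie_suml (I : Type) (s : seq I) (F : I -> V) y :
  br (\sum_(i <- s) F i) y = \sum_(i <- s) br (F i) y.
Proof. exact: (linear_sum (brl y)). Qed.

Lemma lie_sumr (I : Type) (s : seq I) (F : I -> V) x :
  br x (\sum_(i <- s) F i) = \sum_(i <- s) br x (F i).
Proof. exact: (linear_sum (brr x)). Qed.

Lemma lieC x y : br x y = - br y x.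
Proof.
have := lie_alternating lieV (x + y).
rewrite lieDl !lieDr !(lie_alternating lieV) add0r addr0 => /eqP.
by rewrite addr_eq0 => /eqP.
Qed.

End LieBracketTheory.

(** The coordinate functionals of a basis already separate vectors. *)
Lemma dual_ext (k : fieldType) (V : vectType k) (u v : V) :
  (forall zeta : dual V, zeta u = zeta v) -> u = v.
Proof.
move=> uv; rewrite (coord_vbasis (memvf u)) [RHS](coord_vbasis (memvf v)).
apply: eq_bigr => i _; congr (_ *: _).
pose c : {linear V -> k^o} := coord (vbasis {:V}) i.
by have := uv (linfun c); rewrite !lfunE.
Qed.

Lemma dual_linearP (k : fieldType) (V : vectType k) (zeta : dual V) a u v :
  zeta (a *: u + v) = a * zeta u + zeta v.
Proof. exact: linearP. Qed.

Lemma dual_linear_lfunE (k : fieldType) (V : vectType k)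
    (xi eta : dual V) a u :
  (a *: xi + eta) u = a * xi u + eta u.
Proof. by rewrite add_lfunE scale_lfunE. Qed.

Lemma sub_lfunE (k : fieldType) (U V : vectType k) (f h : 'Hom(U, V)) u :
  (f - h) u = f u - h u.
Proof. by rewrite add_lfunE opp_lfunE. Qed.

(** * Pairing a tensor with two functionals *)

Section TensorForm.

Variables (k : fieldType) (U V : vectType k).

(** The functional [xi] (x) [eta] on U (x) V; its value at [gamma x] is
    [dual_bracket gamma xi eta x]. *)
Definition tens_form (xi : dual U) (eta : dual V) : tensor U V -> k^o :=
  tens_lift (fun u v => (xi u * eta v : k^o)).

HB.instance Definition _ xi eta :=
  GRing.isLinear.Build k (tensor U V) k^o _ (tens_form xi eta)
    (tens_lift_linear _).

Lemma tens_form_tens xi eta u v : tens_form xi eta (u \ox v) = xi u * eta v.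
Proof.
apply: tens_lift_tens => [y|x] a z z'; rewrite linearP.
  by rewrite -[RHS]/(a * (xi z * eta y) + xi z' * eta y) mulrA -mulrDl.
by rewrite -[RHS]/(a * (xi x * eta z) + xi x * eta z') mulrCA -mulrDr.
Qed.

Lemma tens_form_sum (I : Type) (s : seq I) (F : I -> U) (G : I -> V) xi eta :
  tens_form xi eta (\sum_(i <- s) F i \ox G i) =
    \sum_(i <- s) xi (F i) * eta (G i).
Proof. by rewrite linear_sum; apply: eq_bigr => i _; exact: tens_form_tens. Qed.

End TensorForm.

(** * The Lie algebra structure of the double *)

Section Double.

Variables (k : fieldType) (g : vectType k) (br : g -> g -> g).
Variable gamma : 'Hom(g, tensor g g).
Hypothesis lieg : lie_bracket br.

Local Notation dbr := (dual_bracket gamma).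
Local Notation "[ a , b ]D" := (double_bracket br gamma a b)
  (at level 0, format "[ a ,  b ]D").
Implicit Types (x y z w : g) (xi eta zeta theta : dual g).

(** [ad2] acts as a derivation on the two legs, and [coad] is minus the transpose of the adjoint
    action, whence the signs. *)
Lemma tens_form_ad2 xi eta x t :
  tens_form xi eta (ad2 br x t) =
    - tens_form (coad br x xi) eta t - tens_form xi (coad br x eta) t.
Proof.
rewrite /ad2 /tens_lift linear_sum -!sumrN -big_split; apply: eq_bigr => i _ /=.
rewrite linear_sum -!sumrN -big_split; apply: eq_bigr => j _ /=.
rewrite linearZ linearD /= !tens_form_tens !coadE; try exact: lie_linearr lieg x.
by rewrite /GRing.scale /=; ring.
Qed.

Hypothesis lied : lie_bracket dbr.

(** Testing on [theta] turns [dual_coad] into a dual bracket, which removes the inverse of [bidual]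
    from later computations. *)
Lemma double_bracket1E a b theta :
  theta [a, b]D.1 =
    theta (br a.1 b.1) + dbr b.2 theta a.1 - dbr a.2 theta b.1.
Proof.
case: a b => [x xi] [y eta] /=; rewrite linearD linearB /=.
by rewrite !dual_coadE ?opprK //; exact: lie_linearr lied _.
Qed.

Lemma double_bracket2E a b w :
  [a, b]D.2 w = dbr a.2 b.2 w - b.2 (br a.1 w) + a.2 (br b.1 w).
Proof.
case: a b => [x xi] [y eta] /=; rewrite sub_lfunE add_lfunE.
by rewrite !coadE ?opprK //; exact: lie_linearr lieg _.
Qed.

Lemma double_bracket2 a b :
  [a, b]D.2 = dbr a.2 b.2 + coad br a.1 b.2 - coad br b.1 a.2.
Proof. by case: a b => [x xi] [y eta]. Qed.

Hypothesis cocycle : forall x y,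
  gamma (br x y) = ad2 br x (gamma y) - ad2 br y (gamma x).

(** The cocycle condition for [gamma], paired with [xi] (x) [eta]. *)
Lemma dual_bracket_br xi eta x y :
  dbr xi eta (br x y) =
    dbr (coad br y xi) eta x + dbr xi (coad br y eta) x
    - dbr (coad br x xi) eta y - dbr xi (coad br x eta) y.
Proof.
have dE xi' eta' z : dbr xi' eta' z = tens_form xi' eta' (gamma z).
  exact: dual_bracketE.
by rewrite !dE cocycle linearB /= !tens_form_ad2; ring.
Qed.

Lemma dual_bracket_jacobi xi eta zeta x :
  dbr (dbr xi eta) zeta x = dbr xi (dbr eta zeta) x - dbr eta (dbr xi zeta) x.
Proof.
have := congr1 (fun f : dual g => f x) (lie_jacobi lied xi eta zeta).
rewrite !lfunE /= !lfunE /= (lieC lied zeta xi) (lieNr lied) (lieC lied zeta).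
by rewrite !lfunE /= => /subr0_eq.
Qed.

Lemma double_jacobi1 a b c theta :
  theta ([a, [b, c]D]D + [b, [c, a]D]D + [c, [a, b]D]D).1 = 0.
Proof.
have coadN x zeta y : zeta (br x y) = - coad br x zeta y.
  by rewrite coadE ?opprK //; exact: lie_linearr lieg x.
have jg : coad br a.1 theta (br b.1 c.1) + coad br b.1 theta (br c.1 a.1)
    + coad br c.1 theta (br a.1 b.1) = 0.
  apply: oppr_inj; rewrite !opprD -!coadN -!linearD /=.
  by rewrite (lie_jacobi lieg) linear0 oppr0.
rewrite !linearD /= !double_bracket1E !double_bracket2 !(coadN _ theta).
rewrite !double_bracket1E !(lieBl lied) !(lieDl lied) !sub_lfunE !add_lfunE.
rewrite !dual_bracket_br !dual_bracket_jacobi.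
(* All terms containing the dual bracket cancel; what remains is minus the Jacobi sum of g. *)
apply: etrans (_ : - (coad br a.1 theta (br b.1 c.1)
  + coad br b.1 theta (br c.1 a.1) + coad br c.1 theta (br a.1 b.1)) = 0);
  last by rewrite jg oppr0.
ring.
Qed.

Lemma double_jacobi2 a b c w :
  ([a, [b, c]D]D + [b, [c, a]D]D + [c, [a, b]D]D).2 w = 0.
Proof.
have coadC x zeta y : zeta (br x y) = coad br y zeta x.
  by rewrite coadE ?(lieC lieg x) ?linearN //; exact: lie_linearr lieg y.
have jg zeta x y : coad br w zeta (br x y) =
    zeta (br x (br y w)) - zeta (br y (br x w)).
  have := congr1 zeta (lie_jacobi lieg x y w).
  rewrite !linearD /= linear0 -coadC (lieC lieg w (br x y)) (lieC lieg w x).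
  by rewrite (lieNr lieg) !linearN /= => /subr0_eq.
have jd : dbr a.2 (dbr b.2 c.2) w + dbr b.2 (dbr c.2 a.2) w
    + dbr c.2 (dbr a.2 b.2) w = 0.
  by rewrite -!add_lfunE (lie_jacobi lied) lfunE.
(* A fixed order of the arguments lets [ring] recognise equal terms. *)
have dC x y xi eta : dbr (coad br x xi) eta y = - dbr eta (coad br x xi) y.
  by rewrite (lieC lied) opp_lfunE.
(* Absorbing [w] into the functional exposes the first component of the inner bracket, so
   [double_bracket1E] applies with [coad br w a.2] as test functional. *)
rewrite /= !add_lfunE !double_bracket2E (coadC _ a.2 w) (coadC _ b.2 w).
rewrite (coadC _ c.2 w) !double_bracket1E.
rewrite !jg !double_bracket2 !(lieBr lied) !(lieDr lied) !sub_lfunE !add_lfunE.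
rewrite !dual_bracket_br !dC -[RHS]jd.
ring.
Qed.
Lemma double_bracket_linearl b : linear (double_bracket br gamma ^~ b).
Proof.
move=> s a c; rewrite [LHS]surjective_pairing [RHS]surjective_pairing.
congr (_, _).
  apply: dual_ext => theta; rewrite [RHS]dual_linearP !double_bracket1E /=.
  by rewrite (lie_linearl lieg) (lie_linearl lied) !dual_linearP
    !dual_linear_lfunE; ring.
apply/lfunP => w; rewrite [RHS]dual_linear_lfunE !double_bracket2E /=.
by rewrite (lie_linearl lieg) (lie_linearl lied) !dual_linearP
  !dual_linear_lfunE; ring.
Qed.

Lemma double_bracketC a b : [a, b]D = - [b, a]D.
Proof.
rewrite [LHS]surjective_pairing [RHS]surjective_pairing.
congr (_, _).
  apply: dual_ext => theta; rewrite -[RHS]/(theta (- [b, a]D.1)).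
  have -> u : theta (- u) = - theta u by rewrite linearN.
  rewrite !double_bracket1E.
  by rewrite (lieC lieg b.1) linearN /=; ring.
apply/lfunP => w; rewrite -[RHS]/((- [b, a]D.2) w) opp_lfunE !double_bracket2E.
by rewrite (lieC lied b.2) opp_lfunE; ring.
Qed.

Lemma double_lie_bracket : lie_bracket (double_bracket br gamma).
Proof.
split=> [b|a s b c|a|a b c]; first exact: double_bracket_linearl.
- rewrite !(double_bracketC a) double_bracket_linearl.
  by rewrite opprD scalerN.
- rewrite [LHS]surjective_pairing; congr (_, _).
    apply: dual_ext => theta; rewrite double_bracket1E.
    by rewrite (lie_alternating lieg) !linear0; ring.
  apply/lfunP => w; rewrite double_bracket2E (lie_alternating lied) !lfunE /=.
  by ring.
rewrite [LHS]surjective_pairing; congr (_, _).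
  by apply: dual_ext => theta; rewrite double_jacobi1 linear0.
by apply/lfunP => w; rewrite double_jacobi2 lfunE.
Qed.

(** * The r-matrix as a Lie algebra morphism from the double to g *)

Variable r : seq (g * g).
Hypothesis cybe_r : cybe br r.
Hypothesis gamma_r : forall x, gamma x = ad2 br x (\sum_(p <- r) p.1 \ox p.2).

Definition rmap xi : g := \sum_(p <- r) xi p.1 *: p.2.

Lemma rmapE xi zeta : zeta (rmap xi) = \sum_(p <- r) xi p.1 * zeta p.2.
Proof. by rewrite linear_sum; apply: eq_bigr => p _; rewrite linearZ. Qed.

Lemma rmap_linear : linear rmap.
Proof.
move=> a xi eta; rewrite scaler_sumr -big_split; apply: eq_bigr => p _ /=.
by rewrite dual_linear_lfunE scalerDl scalerA.
Qed.

HB.instance Definition _ := GRing.isLinear.Build k (dual g) g _ rmap rmap_linear.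

(** Pairing [r] with [xi] (x) [eta] gives [eta (rmap xi)], so [gamma_r] and [tens_form_ad2] yield
    one term per leg. *)
Lemma dual_bracket_rmap xi eta x :
  dbr xi eta x = - eta (rmap (coad br x xi)) - coad br x eta (rmap xi).
Proof.
rewrite !rmapE dual_bracketE gamma_r -/(tens_form _ _ _) tens_form_ad2.
by rewrite !tens_form_sum.
Qed.

Lemma cybe_form xi eta zeta :
  \sum_(p <- r) \sum_(p' <- r) xi (br p.1 p'.1) * eta p.2 * zeta p'.2
  + \sum_(p <- r) \sum_(p' <- r) xi p.1 * eta (br p.2 p'.1) * zeta p'.2
  + \sum_(p <- r) \sum_(p' <- r) xi p.1 * eta p'.1 * zeta (br p.2 p'.2) = 0.
Proof.
(* Triple tensors are nested to the left, so [xi] and [eta] are first bundled into one functional on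
   g (x) g. *)
have := congr1 (tens_form (linfun (tens_form xi eta)) zeta) cybe_r.
rewrite !linearD linear0 /= => e; rewrite -[RHS]e.
by congr (_ + _ + _); rewrite linear_sum; apply: eq_bigr => p _;
  rewrite [RHS]tens_form_sum; apply: eq_bigr => p' _; rewrite lfunE /=
  tens_form_tens.
Qed.

Lemma rmap_morph xi eta : rmap (dbr xi eta) = br (rmap xi) (rmap eta).
Proof.
apply: dual_ext => zeta; apply/esym/eqP; rewrite -subr_eq0; apply/eqP.
(* The third sum of the Yang-Baxter equation is the bracket of the images; the first two together
   are minus the image of the dual bracket. *)
rewrite -[RHS](cybe_form xi eta zeta) [RHS]addrC; congr (_ + _).
  rewrite (lie_suml lieg) linear_sum; apply: eq_bigr => p _ /=.
  rewrite (lie_sumr lieg) linear_sum; apply: eq_bigr => p' _ /=.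
  by rewrite (lieZl lieg) (lieZr lieg) !linearZ /= -mulrA.
(* The outer index becomes the one whose second leg is paired with [zeta], as in [rmapE]. *)
rewrite [X in X + _]exchange_big [X in _ + X]exchange_big -big_split /= rmapE -sumrN.
apply: eq_bigr => p _; rewrite dual_bracket_rmap !rmapE.
rewrite -opprD mulNr opprK mulrDl !mulr_suml.
by congr (_ + _); apply: eq_bigr => p' _; rewrite coadE ?(lieC lieg p.1)
  ?linearN ?opprK //; exact: lie_linearr lieg _.
Qed.

(** Compatibility with the mixed bracket: as [dual_bracket gamma eta zeta x] is minus the value of
    [zeta] at ad*_eta x, this reads R ad*_x eta - ad*_eta x = [x, R eta]. *)
Lemma rmap_coad x eta zeta :
  zeta (rmap (coad br x eta)) = zeta (br x (rmap eta)) - dbr eta zeta x.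
Proof.
rewrite dual_bracket_rmap coadE; last exact: lie_linearr lieg x.
by ring.
Qed.

Definition double_proj a : g := a.1 + rmap a.2.

Lemma double_proj_linear : linear double_proj.
Proof. by move=> s a b; rewrite /double_proj /= linearP scalerDr addrACA. Qed.

Lemma double_proj_morph a b :
  double_proj [a, b]D = br (double_proj a) (double_proj b).
Proof.
apply: dual_ext => zeta; rewrite /double_proj linearD /= double_bracket1E.
have -> : rmap [a, b]D.2 = br (rmap a.2) (rmap b.2)
    + rmap (coad br a.1 b.2) - rmap (coad br b.1 a.2).
  by rewrite double_bracket2 !linearD linearN /= rmap_morph.
have zetaB u v : zeta (u - v) = zeta u - zeta v by exact: linearB.
rewrite zetaB linearD /=.
(* The dual brackets produced by [rmap_coad] cancel those in the first component of the double
   bracket. *)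
rewrite !rmap_coad !(lieDl lieg) !(lieDr lieg) !linearD /=.
by rewrite (lieC lieg (rmap a.2) b.1) linearN /=; ring.
Qed.

End Double.

Theorem theorem5p6 (k : fieldType) (char0 : [pchar k] =i pred0)
    (g : vectType k) (gbr : g -> g -> g) (gamma : 'Hom(g, tensor g g))
    (hg : lie_bialgebra gbr gamma) (hr : quasitriangular gbr gamma)
    (q : lmodType k) (qbr : q -> q -> q) (beta : {skew_symmetric q})
    (phi : g -> {linear q -> q})
    (hq : equivariant_quasi_frobenius gbr qbr beta phi) :
  exists rho : drinfeld_double g -> {linear q -> q},
    (forall x u, rho (x, 0) u = phi x u) /\
    equivariant_quasi_frobenius (double_bracket gbr gamma) qbr beta rho.
Proof.
case: hg hr => lieg _ lied cocycle [r cybe_r gamma_r].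
case: hq => _ qfq [phi_linear phi_bracket] phi_der phi_inv.
exists (fun a => phi (double_proj r a)); split=> [x u|].
  by rewrite /double_proj linear0 addr0.
(* Each operator of the new representation is [phi] of some element of g, so the derivation and
   invariance properties carry over at once. *)
split=> //; first exact: double_lie_bracket.
split=> [u s a b|a b u]; first by rewrite double_proj_linear phi_linear.
by rewrite (double_proj_morph lieg lied cybe_r gamma_r) phi_bracket.
Qed.
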